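(* For every $r\in\mathbb Q\cap(0,1)$, with $s=s(r)$ and $t=t(r)$, the three points \[ (s^\infty,\,ts^\infty),\qquad (st^\infty,\,ts^\infty),\qquad (st^\infty,\,t^\infty) \] are on the boundary of $D_2$. In particular, $(st^\infty,ts^\infty)$ is a corner of $D_2$. Furthermore, $(s^\infty,ts^\infty)$ and $(st^\infty,t^\infty)$ are limit points of corners of $D_2$.
   Context: Let $T:[0,1]\to[0,1]$ be the doubling map: $Tx=2x$ for $x\in[0,1/2]$ and $Tx=2x-1$ for $x\in(1/2,1]$. An $n$-cycle is a periodic orbit of $T$ of prime (least) period $n$. For $a<b$, an integer $n\ge 3$ is called bad for $(a,b)$ if every $n$-cycle of $T$ has non-empty intersection with the open interval $(a,b)$. $B(a,b)$ denotes the set of all $n\ge3$ which are bad for $(a,b)$, and \[ D_2=\{(a,b)\in(1/4,1/2)\times(1/2,3/4): B(a,b)\text{ is finite}\}. \] A point $(a,b)$ is a corner of $D_2$ if for all $(a',b')$ sufficiently close to $(a,b)$: if $a'>a$ or $b'<b$ then $(a',b')\in D_2$; and if $a'<a$ and $b'>b$ then $(a',b')\notin D_2$. Words are over the alphabet $\{0,1\}$. An infinite word $w_1w_2\dots$ is identified with the number $\sum_{j\ge1}w_j2^{-j}\in[0,1]$. For finite words, $uv$ is concatenation and $u^\infty=uuu\cdots$. For a finite word $w$, $|w|$ is its length, $|w|_1$ the number of 1s, and its 1-ratio is $|w|_1/|w|$. A word $w$ is balanced if for every $n\ge1$ any two factors (contiguous subwords) $u,v$ of $w$ of length $n$ satisfy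 $\big||u|_1-|v|_1\big|\le1$; a finite word is cyclically balanced if all of its cyclic permutations are balanced. For $r=p/q\in\mathbb Q\cap(0,1)$ in lowest terms, $s(r)$ is the lexicographically largest cyclically balanced word of length $q$ with 1-ratio $r$ beginning with $0$, and $t(r)$ is the lexicographically smallest cyclically balanced word of length $q$ with 1-ratio $r$ beginning with $1$. *)

(* Defs.v *)
From mathcomp Require Import all_boot all_order all_algebra.
From mathcomp Require Import all_classical all_reals all_analysis.

Set Implicit Arguments.
Unset Strict Implicit.
Unset Printing Implicit Defensive.

Import Order.TTheory GRing.Theory Num.Theory numFieldNormedType.Exports.

Local Open Scope classical_set_scope.
Local Open Scope ring_scope.

(* Finite words over {0,1} are bitseq (0 = false, 1 = true); infinite words
   w_1 w_2 ... are functions nat -> bool, with w_(j+1) stored at index j. *)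

Definition ones (w : bitseq) : nat := count_mem true w.

Definition one_ratio (w : bitseq) : rat := (ones w)%:R / (size w)%:R.

Definition balanced (w : bitseq) : Prop :=
  forall (n : nat) (u v : bitseq), (1 <= n)%N ->
    infix u w -> infix v w -> size u = n -> size v = n ->
    `|(ones u)%:Z - (ones v)%:Z| <= 1.

Definition cyclically_balanced (w : bitseq) : Prop :=
  forall k : nat, balanced (rot k w).

(* [denq r] is the positive denominator of r in lowest terms. *)
Definition cb_words (r : rat) (c : bool) : set bitseq :=
  [set w | [/\ (size w)%:Z = denq r, one_ratio w = r,
               cyclically_balanced w & ohead w = Some c]].

Definition lex_le (u v : bitseq) : bool :=
  ((u : seqlexi bool) <= (v : seqlexi bool))%O.

(* [xget [::] A] is an element of A when A is nonempty (here A has at most one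
   element, since the order is total), and [::] otherwise. *)
Definition s_word (r : rat) : bitseq :=
  xget [::] [set w | cb_words r false w /\
                     forall v, cb_words r false v -> lex_le v w].

Definition t_word (r : rat) : bitseq :=
  xget [::] [set w | cb_words r true w /\
                     forall v, cb_words r true v -> lex_le w v].

Definition word_pow_inf (u : bitseq) : nat -> bool :=
  fun j => nth false u (j %% size u)%N.

Definition word_cat_inf (u : bitseq) (w : nat -> bool) : nat -> bool :=
  fun j => if (j < size u)%N then nth false u j else w (j - size u)%N.

Definition word_val (R : realType) (w : nat -> bool) : R :=
  limn (series (fun j : nat => (w j)%:R / 2 ^+ j.+1 : R)).

(* The doubling map, extended to R by the same formulas; only its restriction
   to the invariant interval [0,1] is used. *)
Definition doubling (R : realType) (x : R) : R :=
  if x <= 1 / 2 then 2 * x else 2 * x - 1.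

Definition is_cycle (R : realType) (n : nat) (C : set R) : Prop :=
  (0 < n)%N /\
  exists x : R,
    [/\ 0 <= x <= 1,
        iter n (@doubling R) x = x,
        forall m : nat, (0 < m < n)%N -> iter m (@doubling R) x <> x &
        C = [set iter k (@doubling R) x | k in [set: nat]]].

Definition bad_set (R : realType) (a b : R) : set nat :=
  [set n | (3 <= n)%N /\
           forall C : set R, is_cycle n C -> C `&` [set x | a < x < b] !=set0].

Definition D2 (R : realType) : set (R * R) :=
  [set p | [/\ 1 / 4 < p.1 < 1 / 2, 1 / 2 < p.2 < 3 / 4 &
               finite_set (bad_set p.1 p.2)]].

Definition is_corner (R : realType) (p : R * R) : Prop :=
  \forall p' \near p,
    (p'.1 > p.1 \/ p'.2 < p.2 -> D2 p') /\
    (p'.1 < p.1 /\ p'.2 > p.2 -> ~ D2 p').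

Definition frontier (X : topologicalType) (A : set X) : set X :=
  closure A `\` interior A.

(* Main.v *)
(* For r = p/q, the numbers of 1s among the first k+1 letters are ceil(r k) for
   s^oo, 1 + floor(r k) for t^oo and, for k >= 1, floor(r k) + 1 for st^oo and
   ceil(r k) for ts^oo.  By summation by parts, a word all of whose prefixes
   contain at least as many 1s as those of another word has the larger value,
   so every comparison of points reduces to a comparison of such counts.
   If a cycle has 1-ratio > r, the cycle lemma gives a point of it that starts
   with 0 and afterwards has > r k ones among every k letters, hence lies in
   [st^oo, 1/2]; if the 1-ratio is < r some point lies in [1/2, ts^oo].  So to
   the upper left of (st^oo, ts^oo) every n not divisible by q is bad.
   Conversely, for a > st^oo and b <= t^oo, coding a path whose slope is r on
   most of a period and slightly larger on the rest yields, for every large n,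
   an n-cycle avoiding (a, b); exchanging 0 and 1 handles b < ts^oo.  Thus
   (st^oo, ts^oo) is a corner, for every fraction p/q, reduced or not.  The
   corners of the fractions (pN - 1)/(qN) and (pN + 1)/(qN) converge to
   (s^oo, ts^oo) and (st^oo, t^oo), and the boundary is closed. *)
Require Import Defs.
From mathcomp Require Import all_boot all_order all_algebra.
From mathcomp Require Import all_classical all_reals all_analysis.
From mathcomp Require Import zify ring lra.
Import Order.TTheory GRing.Theory Num.Theory numFieldNormedType.Exports.
Local Open Scope classical_set_scope.
Local Open Scope ring_scope.
Set Implicit Arguments.
Unset Strict Implicit.
Unset Printing Implicit Defensive.

(** * Infinite words and their values *)

Notation word := (nat -> bool).

Definition shift (m : nat) (x : word) : word := fun j => x (m + j)%N.
Definition flip (x : word) : word := fun j => ~~ x j.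
Definition wcons (c : bool) (x : word) : word :=
  fun j => if j is j'.+1 then x j' else c.
Definition cnt (x : word) (k : nat) : nat := (\sum_(0 <= i < k) x i)%N.

Lemma shift0 x : shift 0 x = x.
Proof. by apply/funext. Qed.

Lemma shiftD m n x : shift m (shift n x) = shift (n + m) x.
Proof. by apply/funext => j; rewrite /shift addnA. Qed.

Lemma flipK : involutive flip.
Proof. by move=> x; apply/funext => j; rewrite /flip negbK. Qed.

Lemma shift_flip m x : shift m (flip x) = flip (shift m x).
Proof. by []. Qed.

Lemma cnt0 x : cnt x 0 = 0%N.
Proof. by rewrite /cnt big_nil. Qed.

Lemma cntS x k : cnt x k.+1 = (cnt x k + x k)%N.
Proof. by rewrite /cnt big_nat_recr. Qed.

Lemma cntSl x k : cnt x k.+1 = (x 0%N + cnt (shift 1 x) k)%N.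
Proof. by rewrite /cnt big_nat_recl. Qed.

Lemma cntD x j k : cnt x (j + k) = (cnt x j + cnt (shift j x) k)%N.
Proof.
elim: k => [|k IH]; first by rewrite addn0 cnt0 addn0.
by rewrite addnS !cntS IH addnA.
Qed.

Lemma cnt_le x k : (cnt x k <= k)%N.
Proof. by elim: k => [|k IH]; rewrite ?cnt0 // cntS; case: (x k); lia. Qed.

Lemma cnt_flip x k : cnt (flip x) k = (k - cnt x k)%N.
Proof.
elim: k => [|k IH]; first by rewrite !cnt0.
by rewrite !cntS IH /flip; have := cnt_le x k; case: (x k) => /=; lia.
Qed.

Lemma cnt_wcons c x k : cnt (wcons c x) k.+1 = (c + cnt x k)%N.
Proof. by rewrite cntSl. Qed.

Lemma eq_cnt x y : (forall k, cnt x k = cnt y k) -> x = y.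
Proof.
move=> e; apply/funext => j; have := e j.+1.
by rewrite !cntS e; case: (x j); case: (y j); lia.
Qed.

Definition psum (R : realType) (x : word) (n : nat) : R :=
  \sum_(0 <= j < n) (x j)%:R / 2 ^+ j.+1.

Lemma psum_series (R : realType) x :
  psum R x = series (fun j => (x j)%:R / 2 ^+ j.+1 : R).
Proof. by apply/funext => n; rewrite /psum seriesEnat. Qed.

Lemma psum0 (R : realType) x : psum R x 0 = 0.
Proof. by rewrite /psum big_nil. Qed.

Lemma psumS (R : realType) x n :
  psum R x n.+1 = psum R x n + (x n)%:R / 2 ^+ n.+1.
Proof. by rewrite /psum big_nat_recr. Qed.

Lemma exp2V_gt0 (R : realType) n : 0 < (2 ^+ n)^-1 :> R.
Proof. by rewrite invr_gt0 exprn_gt0. Qed.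

Lemma exp2VS (R : realType) n : (2 ^+ n)^-1 = 2 * (2 ^+ n.+1)^-1 :> R.
Proof. by rewrite exprS; field; rewrite expf_neq0 // pnatr_eq0. Qed.

Lemma psum_nondecreasing (R : realType) x : nondecreasing_seq (psum R x).
Proof.
apply/nondecreasing_seqP => n; rewrite psumS lerDl.
by rewrite divr_ge0 // exprn_ge0.
Qed.

(** The subtracted [(2 ^+ n)^-1] is the most that the letters after the first [n] can still add;
    keeping it lets the induction close. *)
Lemma psum_bound (R : realType) x m n : (m <= n)%N ->
  psum R x n <= psum R x m + (2 ^+ m)^-1 - (2 ^+ n)^-1.
Proof.
move=> /subnK <-; elim: (n - m)%N => [|k IH]; first by rewrite add0n addrK.
rewrite addSn psumS.
apply: le_trans (lerD IH (_ : _ <= (2 ^+ (k + m).+1)^-1)) _.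
  by rewrite ler_piMl ?(ltW (exp2V_gt0 R _)) //; case: (x _); rewrite ?ler01.
by rewrite (exp2VS R (k + m)); lra.
Qed.

Lemma cvg_psum (R : realType) x : cvgn (psum R x).
Proof.
apply: nondecreasing_is_cvgn (@psum_nondecreasing R x) _.
exists 1 => _ [n _ <-]; have := psum_bound R x (leq0n n).
by rewrite psum0 expr0; have := exp2V_gt0 R n; lra.
Qed.

Lemma valE (R : realType) x : word_val R x = limn (psum R x).
Proof. by rewrite psum_series. Qed.

Lemma psum_le_val (R : realType) x n : psum R x n <= word_val R x.
Proof.
rewrite valE; apply: nondecreasing_cvgn_le; first exact: psum_nondecreasing.
exact: cvg_psum.
Qed.

Lemma val_le_psum (R : realType) x n : word_val R x <= psum R x n + (2 ^+ n)^-1.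
Proof.
rewrite valE; apply: limr_le; first exact: cvg_psum.
exists n => // k /= nk; have := psum_bound R x nk.
by have := exp2V_gt0 R k; lra.
Qed.

Lemma exp2V_small (R : realType) (e : R) : 0 < e -> exists n, (2 ^+ n)^-1 < e.
Proof.
move=> e0; have [n _ h] := near_infty_natSinv_expn_lt (PosNum e0).
by exists n; have := h n (leqnn n); rewrite /= div1r.
Qed.

Lemma val_squeeze (R : realType) x v :
  (forall n, `|v - psum R x n| <= (2 ^+ n)^-1) -> v = word_val R x.
Proof.
move=> h; apply/eqP; rewrite -subr_eq0 -normr_le0; apply/ler_addgt0Pl => e e0.
rewrite addr0.
have [n ne] := exp2V_small (divr_gt0 e0 (ltr0n R 2)).
have := h n; have := psum_le_val R x n; have := val_le_psum R x n.
rewrite !ler_norml; lra.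
Qed.


Lemma val_ge0 (R : realType) x : 0 <= word_val R x.
Proof. by have := psum_le_val R x 0; rewrite psum0. Qed.

Lemma val_le1 (R : realType) x : word_val R x <= 1.
Proof. by have := val_le_psum R x 0; rewrite psum0 expr0 invr1 add0r. Qed.

Lemma psum_shift (R : realType) x n :
  psum R x n.+1 = (x 0%N)%:R / 2 + psum R (shift 1 x) n / 2.
Proof.
rewrite /psum big_nat_recl //= expr1; congr (_ + _).
rewrite mulr_suml; apply: eq_bigr => i _.
by rewrite (exprSr _ i.+1) invfM mulrA.
Qed.

Lemma val_shift (R : realType) x :
  word_val R x = (x 0%N)%:R / 2 + word_val R (shift 1 x) / 2.
Proof.
apply/esym/val_squeeze => n.
have h1 := psum_le_val R (shift 1 x); have h2 := val_le_psum R (shift 1 x).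
case: n => [|n].
  rewrite psum0 subr0 expr0 invr1; have := val_ge0 R (shift 1 x).
  have := val_le1 R (shift 1 x); rewrite ler_norml.
  by case: (x 0%N); rewrite /=; lra.
have := h1 n; have := h2 n; have := exp2V_gt0 R n.
rewrite psum_shift exp2VS ler_norml.
by lra.
Qed.

Lemma val_flip (R : realType) x : word_val R (flip x) = 1 - word_val R x.
Proof.
apply/esym/val_squeeze => n.
suff -> : psum R (flip x) n = 1 - (2 ^+ n)^-1 - psum R x n.
  have := psum_le_val R x n; have := val_le_psum R x n; rewrite ler_norml; lra.
elim: n => [|n IH]; first by rewrite !psum0 expr0 invr1 subrr subr0.
by rewrite !psumS IH (exp2VS R n) /flip; case: (x n) => /=; lra.
Qed.

(** Summation by parts: a 1 at index [j] is counted in every longer prefix, and the weights of those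
    prefixes add up to [(2 ^+ j.+1)^-1]. *)
Lemma psum_cnt (R : realType) x n :
  psum R x n = \sum_(0 <= k < n) (cnt x k)%:R / 2 ^+ k.+1 + (cnt x n)%:R / 2 ^+ n.
Proof.
elim: n => [|n IH]; first by rewrite psum0 big_nil cnt0 mul0r addr0.
rewrite psumS IH big_nat_recr //= cntS natrD exp2VS; lra.
Qed.

Lemma psum_le (R : realType) x y n :
  (forall k, (k <= n)%N -> (cnt x k <= cnt y k)%N) -> psum R x n <= psum R y n.
Proof.
move=> h; rewrite !psum_cnt; apply: lerD.
  apply: ler_sum_nat => k /andP[_ kn].
  by rewrite ler_wpM2r ?invr_ge0 ?exprn_ge0 // ler_nat h // ltnW.
by rewrite ler_wpM2r ?invr_ge0 ?exprn_ge0 // ler_nat h.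
Qed.

Lemma val_le_near (R : realType) x y n :
  (forall k, (k <= n)%N -> (cnt x k <= cnt y k)%N) ->
  word_val R x <= word_val R y + (2 ^+ n)^-1.
Proof.
move=> /(psum_le R); have := val_le_psum R x n; have := psum_le_val R y n; lra.
Qed.

Lemma val_near (R : realType) x y n :
  (forall k, (k <= n)%N -> cnt x k = cnt y k) ->
  `|word_val R x - word_val R y| <= (2 ^+ n)^-1.
Proof.
move=> h; have h1 : word_val R x <= word_val R y + (2 ^+ n)^-1.
  by apply: val_le_near => k /h ->.
have h2 : word_val R y <= word_val R x + (2 ^+ n)^-1.
  by apply: val_le_near => k /h ->.
by rewrite ler_norml; lra.
Qed.

Lemma val_le (R : realType) x y :
  (forall k, (cnt x k <= cnt y k)%N) -> word_val R x <= word_val R y.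
Proof.
move=> h; apply/ler_addgt0Pr => e /exp2V_small[n] /ltW ne.
by apply: le_trans (val_le_near (n := n) _ _) _ => //; rewrite lerD2l.
Qed.

(** In the summed-by-parts form, the prefix of length [m] alone contributes a gap of at least
    [(2 ^+ m.+1)^-1], and no other term is negative. *)
Lemma val_lt (R : realType) x y m :
  (forall k, (cnt x k <= cnt y k)%N) -> (cnt x m < cnt y m)%N ->
  word_val R x < word_val R y.
Proof.
move=> h hm.
suff hn n : (m < n)%N -> psum R x n + (2 ^+ m.+1)^-1 <= psum R y n.
  rewrite -subr_gt0; apply: lt_le_trans (exp2V_gt0 R m.+2) _.
  (* Truncating after [m.+4] letters costs at most an eighth of the gap, so more than half of it
     survives. *)
  have H := hn (m.+4) ltac:(lia); have := val_le_psum R x m.+4.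
  have := psum_le_val R y m.+4; move: H.
  rewrite (exp2VS R m.+1) (exp2VS R m.+2) (exp2VS R m.+3); have := exp2V_gt0 R m.+4.
  lra.
move=> mn; rewrite !psum_cnt addrAC; apply: lerD; last first.
  by rewrite ler_pM2r ?exp2V_gt0 // ler_nat.
have le_term k : (cnt x k)%:R / 2 ^+ k.+1 <= (cnt y k)%:R / 2 ^+ k.+1 :> R.
  by rewrite ler_pM2r ?exp2V_gt0 // ler_nat.
elim: n mn => // n IH; rewrite ltnS leq_eqVlt !big_nat_recr //=.
case/orP=> [/eqP<-|/IH]; last by have := le_term n; lra.
rewrite -addrA; apply: lerD; first exact: ler_sum.
by rewrite -{2}[_^-1]mul1r -mulrDl ler_pM2r ?exp2V_gt0 // natr1 ler_nat.
Qed.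

Implicit Types x y : word.

(** * Cycles of the doubling map as periodic words *)

Definition prim (n : nat) (x : word) : Prop :=
  shift n x = x /\ forall m, (0 < m < n)%N -> shift m x <> x.

(** The first letter tells on which side of 1/2 a point lies, so for [a < 1 / 2 < b] missing the
    interval splits into one inequality per letter. *)
Definition avoids (R : realType) (a b : R) (n : nat) (x : word) : Prop :=
  prim n x /\ forall j, if x j then b <= word_val R (shift j x)
                        else word_val R (shift j x) <= a.

Lemma shift_mul n k x : shift n x = x -> shift (k * n) x = x.
Proof.
move=> e; elim: k => [|k IH]; first exact: shift0.
by rewrite mulSn -shiftD e.
Qed.

Lemma shift_modn n k x : shift n x = x -> shift (k %% n) x = shift k x.
Proof.
by move=> e; rewrite {2}(divn_eq k n) -shiftD shift_mul.
Qed.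

Lemma prim_flip n x : prim n x -> prim n (flip x).
Proof.
case=> e h; split=> [|m /h hm]; rewrite shift_flip ?e // => /(can_inj flipK).
exact: hm.
Qed.

(** A periodic word with a constant tail is constant, hence has period 1. This rules out the
    ambiguous dyadic expansions along a cycle. *)
Lemma prim_has c n x i : (1 < n)%N -> prim n x -> exists j, shift i x j = c.
Proof.
move=> n1 [e h]; apply: contrapT => hn; apply: (h 1%N) => //.
have xE j : x j = ~~ c.
  (* Moving index [j] forward by [i * n], a multiple of the period, brings it into the tail that
     starts at [i]. *)
  have -> : x j = shift i x (i * n - i + j)%N.
    by rewrite -{1}(shift_mul i e) /shift addnA subnKC // leq_pmulr // ltnW.
  have : shift i x (i * n - i + j)%N <> c.
    by move=> hc; apply: hn; eexists; exact: hc.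
  by case: (shift _ _ _); case: (c).
by apply/funext => j; rewrite /shift !xE.
Qed.

Lemma val_gt0 (R : realType) x j : x j -> 0 < word_val R x.
Proof.
move=> xj; apply: lt_le_trans (psum_le_val R x j.+1).
rewrite psumS xj div1r ltr_wpDl ?exp2V_gt0 //.
by rewrite -(psum0 R x); apply: psum_nondecreasing.
Qed.

Lemma val_lt1 (R : realType) x j : ~~ x j -> word_val R x < 1.
Proof.
move=> xj; rewrite -subr_gt0 -val_flip; exact: (@val_gt0 _ _ j).
Qed.

(** A later 1 excludes the expansion 1000... of 1/2, the case where the map sends 1/2 to 1 while the
    shifted word has value 0. *)
Lemma doubling_val (R : realType) x j :
  x j.+1 -> doubling (word_val R x) = word_val R (shift 1 x).
Proof.
move=> /(@val_gt0 R (shift 1 x) j); have := val_le1 R (shift 1 x).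
rewrite /doubling (val_shift R x); case: (x 0%N) => /= h0 h1; last first.
  by rewrite ifT; lra.
by rewrite ifF; [lra | apply/negbTE; rewrite -ltNge; lra].
Qed.

Lemma iter_doubling_val (R : realType) n x k : (1 < n)%N -> prim n x ->
  iter k (@doubling R) (word_val R x) = word_val R (shift k x).
Proof.
move=> n1 px; elim: k => [|k IH]; first by rewrite shift0.
have [j hj] := @prim_has true n x k.+1 n1 px.
rewrite iterS IH (@doubling_val _ _ j) ?shiftD ?addn1 //.
by move: hj; rewrite /shift addSnnS => ->.
Qed.

Lemma val_gt_half (R : realType) x j : x j.+1 ->
  (1 / 2 < word_val R x) = x 0%N.
Proof.
move=> /(@val_gt0 R (shift 1 x) j); have := val_le1 R (shift 1 x).
rewrite (val_shift R x); case: (x 0%N) => /= h0 h1; first by lra.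
by apply/negbTE; rewrite -leNgt; lra.
Qed.

(** Equal values have equal orbits, and each letter is read off by comparing the orbit point with
    1/2. *)
Lemma val_inj_prim (R : realType) n x m : (1 < n)%N -> prim n x ->
  word_val R (shift m x) = word_val R x -> shift m x = x.
Proof.
move=> n1 px e; apply/funext => k.
have e2 : word_val R (shift (m + k) x) = word_val R (shift k x).
  by rewrite -(iter_doubling_val _ _ n1 px) addnC iterD
    (iter_doubling_val _ _ n1 px) e (iter_doubling_val _ _ n1 px).
have [j hj] := @prim_has true n x (m + k).+1 n1 px.
have [i hi] := @prim_has true n x k.+1 n1 px.
have := @val_gt_half R (shift (m + k) x) j; rewrite e2 (@val_gt_half R _ i).
  by rewrite /shift !addn0 => -> //; rewrite -addSnnS; exact: hj.
by rewrite /shift -addSnnS; exact: hi.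
Qed.

Lemma prim_cycle (R : realType) n x : (1 < n)%N -> prim n x ->
  is_cycle n [set word_val R (shift k x) | k in [set: nat]].
Proof.
move=> n1 px; split; first exact: ltnW.
exists (word_val R x); split.
- by rewrite val_ge0 val_le1.
- by rewrite (iter_doubling_val _ _ n1 px) px.1.
- move=> m /px.2 hm; rewrite (iter_doubling_val _ _ n1 px) => e.
  exact: hm (val_inj_prim n1 px e).
- by apply: eq_imagel => k _; rewrite (iter_doubling_val _ _ n1 px).
Qed.

Lemma doubling_bounds (R : realType) (v : R) : 0 <= v <= 1 ->
  0 <= doubling v <= 1.
Proof. by rewrite /doubling; case: ifPn; rewrite -?ltNge; lra. Qed.

Lemma cycle_prim (R : realType) n (C : set R) : (1 < n)%N -> is_cycle n C ->
  exists2 x, prim n x & C = [set word_val R (shift k x) | k in [set: nat]].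
Proof.
move=> n1 [_ [v [v01 vn vm ->]]].
pose T := @doubling R.
have b k : 0 <= iter k T v <= 1 by elim: k => //= k; exact: doubling_bounds.
(* The itinerary; the strict inequality matches the convention that 1/2 belongs to the left
   branch. *)
pose x : word := fun j => 1 / 2 < iter j T v.
have valT k : iter k T v = word_val R (shift k x).
  apply: val_squeeze => m.
  (* After [m] itinerary digits the remainder is the [m]-th iterate scaled down by [2 ^+ m]. *)
  suff -> : iter k T v - psum R (shift k x) m = iter (k + m) T v / 2 ^+ m.
    case/andP: (b (k + m)%N) => b0 b1; have := exp2V_gt0 R m => e.
    by rewrite ger0_norm ?mulr_ge0 ?(ltW e) // ler_piMl // ltW.
  elim: m => [|m IH]; first by rewrite psum0 subr0 addn0 expr0 divr1.
  rewrite psumS opprD addrA IH exp2VS addnS iterS /shift /x /T /doubling.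
  by case: ltP => /= h; lra.
exists x; last by apply: eq_imagel => k _; rewrite -valT.
have xT k : shift k x = fun j => 1 / 2 < iter j T (iter k T v).
  by apply/funext => j; rewrite /shift /x -iterD addnC.
split=> [|m mn e]; first by rewrite xT vn.
by apply: (vm m mn); rewrite -/T valT e -[x]shift0 -valT.
Qed.

Lemma bad_setP (R : realType) (a b : R) n : (3 <= n)%N -> a < 1 / 2 < b ->
  bad_set a b n <-> ~ exists x, avoids a b n x.
Proof.
move=> n3 /andP[a2 b2]; have n1 : (1 < n)%N by lia.
have half x : if x 0%N then 1 / 2 <= word_val R x else word_val R x <= 1 / 2.
  have := val_ge0 R (shift 1 x); have := val_le1 R (shift 1 x).
  by rewrite (val_shift R x); case: (x 0%N) => /=; lra.
split=> [[_ h] [x [px hx]] | h].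
  have [_ [[k _ <-] /= /andP[ak kb]]] := h _ (prim_cycle R n1 px).
  by have := hx k; case: (x k); lra.
split=> // C /(cycle_prim n1) [x px ->].
apply: contrapT => hC; apply: h; exists x; split=> // j.
have := half (shift j x); rewrite /shift addn0.
case: ifP => _ hh; rewrite leNgt; apply/negP => hj; apply: hC;
  exists (word_val R (shift j x)); split; try by exists j.
  by rewrite /= hj andbT; apply: lt_le_trans hh.
by rewrite /= hj /=; apply: le_lt_trans hh b2.
Qed.

Lemma avoids_flip (R : realType) (a b : R) n x :
  avoids a b n x -> avoids (1 - b) (1 - a) n (flip x).
Proof.
move=> [px h]; split=> [|j]; first exact: prim_flip.
have := h j; rewrite shift_flip val_flip /flip; case: (x j) => /=; lra.
Qed.

(** * Cycles of 1-ratio different from r *)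

Lemma divn_unique m d c : (c * d <= m < c.+1 * d)%N -> (m %/ d)%N = c.
Proof.
case/andP=> h1 h2; rewrite -(subnKC h1) divnMDl; last by lia.
by rewrite divn_small ?addn0 //; lia.
Qed.

Lemma divn_bounds m d : (0 < d)%N -> (m %/ d * d <= m < (m %/ d).+1 * d)%N.
Proof. by move=> d0; rewrite leq_trunc_div ltn_ceil. Qed.

(* The letters are the increments of [floor (F j / D)], when these are 0 or 1. *)
Definition code (F : nat -> nat) (D : nat) : word :=
  fun j => (F j.+1 %/ D)%N != (F j %/ D)%N.

(** The count telescopes: steps of at most [D] raise the floor by 0 or 1, so each letter equals the
    rise of the floor. *)
Lemma cnt_code F D j k : (0 < D)%N ->
  (forall i, F i <= F i.+1 <= F i + D)%N ->
  (F j %/ D + cnt (shift j (code F D)) k = F (j + k) %/ D)%N.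
Proof.
move=> D0 hF; elim: k => [|k IH]; first by rewrite cnt0 !addn0.
rewrite cntS addnA IH /shift addnS /code.
have /andP[h1 h2] := hF (j + k)%N.
have := leq_div2r D h1; have := leq_div2r D h2; rewrite divnDr // divnn D0.
by case: eqP => /= e; lia.
Qed.

(* For [r = p / q], the words [Tword], [Uword], [Sword], [Vword] are [t^oo],
   [st^oo], [s^oo], [ts^oo]; no reduced fraction is required. *)
Definition Tword (p q : nat) : word := wcons true (code (muln p) q).
Definition Uword (p q : nat) : word :=
  wcons false (wcons true (shift 1 (code (muln p) q))).
Definition Sword (p q : nat) : word := flip (Tword (q - p) q).
Definition Vword (p q : nat) : word := flip (Uword (q - p) q).

Lemma cnt_mech p q k : (p < q)%N -> cnt (code (muln p) q) k = ((p * k) %/ q)%N.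
Proof.
move=> pq; have := @cnt_code (muln p) q 0 k; rewrite shift0 muln0 div0n !add0n.
by apply; [lia | move=> i; rewrite mulnS; lia].
Qed.

Lemma cnt_Tword p q k : (p < q)%N -> cnt (Tword p q) k.+1 = (p * k %/ q).+1.
Proof. by move=> pq; rewrite cnt_wcons cnt_mech. Qed.

Lemma cnt_Uword p q k : (p < q)%N -> cnt (Uword p q) k.+2 = (p * k.+1 %/ q).+1.
Proof.
move=> pq; rewrite !cnt_wcons add0n add1n -cnt_mech // cntSl.
by rewrite /code muln1 divn_small // muln0 div0n.
Qed.

(* [(a + d.-1) %/ d] is the ceiling of [a / d]. *)
Lemma ceil_subn a d k : (0 < d)%N -> (a <= k * d)%N ->
  (k - (k * d - a) %/ d = (a + d.-1) %/ d)%N.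
Proof.
move=> d0 ak; have := divn_bounds (a + d.-1) d0.
set c := ((a + d.-1) %/ d)%N => hc.
have ck : (c <= k)%N by rewrite -ltnS -(ltn_pmul2r d0); lia.
rewrite (@divn_unique _ _ (k - c)) ?subKn //.
by rewrite mulSn !mulnBl; have := leq_mul ck (leqnn d); lia.
Qed.

Lemma cnt_Sword p q k : (0 < p < q)%N ->
  cnt (Sword p q) k.+1 = ((p * k + q.-1) %/ q)%N.
Proof.
move=> /andP[p0 pq]; rewrite cnt_flip cnt_Tword; last by lia.
by rewrite subSS mulnBl [(q * k)%N]mulnC ceil_subn; try nia.
Qed.

Lemma cnt_Vword p q k : (0 < p < q)%N ->
  cnt (Vword p q) k.+2 = ((p * k.+1 + q.-1) %/ q)%N.
Proof.
move=> /andP[p0 pq]; rewrite cnt_flip cnt_Uword; last by lia.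
by rewrite subSS mulnBl [(q * _)%N]mulnC ceil_subn; try nia.
Qed.

(** * Counts over periods and the cycle lemma *)

Lemma cnt_shift_period x n m : shift n x = x -> cnt (shift m x) n = cnt x n.
Proof.
move=> e; apply: (@addnI (cnt x m)); rewrite -cntD addnC cntD e addnC.
by [].
Qed.

Lemma cnt_mul x n a k : shift n x = x ->
  cnt x (a * n + k) = (a * cnt x n + cnt x k)%N.
Proof.
move=> e; elim: a => // a IH.
by rewrite mulSn -addnA cntD e IH mulSn addnA.
Qed.

(* Cycle lemma: start reading right after a minimum of [n * cnt x i - P * i]
   over a period, where [P = cnt x n]. *)
Lemma cycle_lemma x n : (0 < n)%N -> shift n x = x ->
  exists m, forall k, (cnt x n * k <= n * cnt (shift m x) k)%N.
Proof.
move=> n0 e; set P := cnt x n.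
(* The constant [P * n] is added so that the minimised quantity is a natural number. *)
pose G (i : 'I_n) := (n * cnt x i + P * (n - i))%N.
have [i _ hi] := arg_minnP G (erefl : predT (Ordinal n0)).
exists (nat_of_ord i) => k.
have bn : ((i + k) %% n < n)%N by rewrite ltn_mod.
have := hi (Ordinal bn) isT; rewrite /G /=.
have := cntD x i k; have := cnt_mul ((i + k) %/ n) ((i + k) %% n) e.
rewrite -divn_eq -/P => ->; have := divn_eq (i + k) n.
set a := ((i + k) %/ n)%N; set b := ((i + k) %% n)%N in bn *.
move: (cnt x b) (cnt x i) (cnt _ k) (ltn_ord i) => cb ci c lin E1 E2 E3.
have E4 : (n * (a * P + cb) = n * (ci + c))%N by rewrite E2.
have E5 : (P * (i + k) = P * (a * n + b))%N by rewrite E1.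
have E6 : (P * b <= P * n)%N by rewrite leq_mul2l ltnW ?orbT.
have E7 : (P * i <= P * n)%N by rewrite leq_mul2l ltnW ?orbT.
move: E3 E4 E5; rewrite !mulnBr !mulnDr; lia.
Qed.

(** The point sought starts one letter before the position given by the cycle lemma: a 0, then more
    than [p * k / q] ones among any next [k] letters. *)
Lemma high_orbit (R : realType) p q n x :
  (0 < p < q)%N -> (1 < n)%N -> prim n x -> (p * n < q * cnt x n)%N ->
  exists2 j, ~~ x j & word_val R (Uword p q) <= word_val R (shift j x).
Proof.
move=> /andP[p0 pq] n1 px hP; have [e _] := px.
have Pn : (cnt x n < n)%N.
  have [j hj] := @prim_has false n x 0 n1 px.
  have -> : cnt x n = cnt (shift j.+1 x) n by rewrite cnt_shift_period.
  have := cntS (shift j.+1 x) n.-1; rewrite prednK ?(ltnW n1) // => ->.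
  have -> : shift j.+1 x n.-1 = x j.
    by rewrite /shift addSnnS prednK ?(ltnW n1) // -{2}e /shift addnC.
  move: hj; rewrite shift0 => ->; rewrite addn0.
  by apply: leq_ltn_trans (cnt_le _ _) _; lia.
have [m hm] := cycle_lemma (ltnW n1) e.
have sm : shift (m + n.-1).+1 x = shift m x.
  by rewrite -addnS prednK ?(ltnW n1) // addnC -shiftD e.
(* If the period read from [m] ended in 1, its first [n.-1] letters would hold one 1 less than
   [cnt x n], which violates [hm] because [cnt x n < n]. *)
have x0 : ~~ x (m + n.-1)%N.
  apply/negP => hx; have := hm n.-1.
  have := cntS (shift m x) n.-1; rewrite prednK ?(ltnW n1) //.
  rewrite (cnt_shift_period m e) {2}/shift hx; move: (cnt _ _) (cnt _ _) Pn => c P.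
  nia.
exists (m + n.-1)%N => //.
apply: val_le => -[|[|k]]; [by rewrite cnt0 | by rewrite cnt_wcons cnt0 |].
have e0 : shift (m + n.-1) x 0%N = false by rewrite /shift addn0; exact: negbTE.
rewrite cnt_Uword // [leqRHS]cntSl shiftD addn1 sm e0 add0n.
rewrite ltn_divLR; last by lia.
move: (hm k.+1); move: (cnt (shift m x) _) => c hc.
rewrite -(ltn_pmul2l (ltnW n1)) mulnA [(n * p)%N]mulnC.
apply: leq_trans (_ : (q * cnt x n * k.+1 <= _)%N).
  by rewrite ltn_pmul2r.
by rewrite -mulnA mulnA [X in (_ <= X)%N]mulnA [X in (_ <= X)%N]mulnC -mulnA
  leq_mul2l hc orbT.
Qed.

(** [high_orbit] excludes a 1-ratio above [p / q]; applied to [flip x] and [q - p] it excludes one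
    below. *)
Lemma avoids_ratio (R : realType) p q n x (a b : R) :
  (0 < p < q)%N -> (1 < n)%N -> avoids a b n x ->
  a < word_val R (Uword p q) -> word_val R (Vword p q) < b ->
  (p * n = q * cnt x n)%N.
Proof.
move=> pq n1 [px hx] aU Vb; case: (ltngtP (p * n)%N (q * cnt x n)%N) => // h.
  have [j xj hj] := high_orbit R pq n1 px h.
  by exfalso; have := hx j; rewrite (negbTE xj); lra.
have qp : (0 < q - p < q)%N by lia.
have h' : ((q - p) * n < q * cnt (flip x) n)%N.
  rewrite cnt_flip mulnBl mulnBr ltn_sub2l //; apply: leq_trans h _.
  by rewrite leq_mul2r; lia.
have [j xj hj] := high_orbit R qp n1 (prim_flip px) h'.
exfalso; move: hj; rewrite shift_flip val_flip; have := hx j.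
move: xj Vb; rewrite /Vword val_flip.
by rewrite /flip negbK => ->; lra.
Qed.

(** * Long cycles of 1-ratio slightly above r *)

(* Coding of a path whose slope is [p / q] except for a slightly larger slope
   on the last [N] steps of each period [n]; the increase [e] over one period
   is what makes [p * n + e] a multiple of [q]. *)
Definition path_step (p q n N i : nat) : nat :=
  (p * N + (if n - N <= i %% n then q - (p * n) %% q else 0))%N.

Definition path_sum (p q n N j : nat) : nat :=
  (\sum_(0 <= i < j) path_step p q n N i)%N.

Definition path_word (p q n N : nat) : word := code (path_sum p q n N) (q * N).

Lemma path_sumS p q n N j :
  path_sum p q n N j.+1 = (path_sum p q n N j + path_step p q n N j)%N.
Proof. by rewrite /path_sum big_nat_recr. Qed.

Lemma path_sum_bounds p q n N j k :
  (path_sum p q n N j + p * N * k <= path_sum p q n N (j + k)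
     <= path_sum p q n N j + (p * N + q) * k)%N.
Proof.
elim: k => [|k IH]; first by rewrite !muln0 !addn0 leqnn.
by rewrite addnS path_sumS !mulnS /path_step; case: ifP => _; lia.
Qed.

Lemma path_sum_flat p q n N k : (k <= n - N)%N ->
  path_sum p q n N k = (p * N * k)%N.
Proof.
elim: k => [|k IH] kn; first by rewrite muln0 /path_sum big_nil.
rewrite path_sumS IH ?(ltnW kn) // mulnS addnC /path_step ifF ?addn0 //.
by rewrite modn_small; lia.
Qed.

(** The [N] steeper steps lift [p * n * N] to the next strictly larger multiple of [q * N]: the
    increase is [q], not 0, when [q] divides [p * n]. *)
Lemma path_sum_period p q n N : (0 < q)%N -> (N <= n)%N ->
  path_sum p q n N n = (((p * n) %/ q).+1 * (q * N))%N.
Proof.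
move=> q0 Nn.
suff h k : (k <= N)%N -> path_sum p q n N (n - N + k) =
    (p * N * (n - N + k) + (q - (p * n) %% q) * k)%N.
  have := h N (leqnn N); rewrite subnK // => ->.
  have := divn_eq (p * n) q; have := ltn_pmod (p * n) q0.
  set a := (_ %/ q)%N; set r := (_ %% q)%N => rq E.
  have -> : (p * N * n + (q - r) * N = (p * n + (q - r)) * N)%N by lia.
  by rewrite E mulnA; congr (_ * _)%N; rewrite mulSn; lia.
elim: k => [|k IH] kN; first by rewrite addn0 muln0 addn0 path_sum_flat.
rewrite addnS path_sumS IH ?(ltnW kN) // /path_step ifT; last first.
  by rewrite modn_small; lia.
rewrite !mulnS.
move: (_ %% q)%N => z; set w := (q - z)%N; lia.
Qed.

Lemma path_sum_shift p q n N j : (0 < q)%N -> (N <= n)%N ->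
  path_sum p q n N (n + j) =
  (((p * n) %/ q).+1 * (q * N) + path_sum p q n N j)%N.
Proof.
move=> q0 Nn; rewrite -path_sum_period //.
elim: j => [|j IH].
  by rewrite addn0 /path_sum [X in (_ + X)%N]big_nil addn0.
by rewrite addnS !path_sumS IH /path_step modnDl !addnA.
Qed.

Lemma cnt_path_word p q n N j k : (0 < q <= N)%N -> (p < q)%N ->
  (path_sum p q n N j %/ (q * N) + cnt (shift j (path_word p q n N)) k =
   path_sum p q n N (j + k) %/ (q * N))%N.
Proof.
move=> qN pq; apply: cnt_code => [|i]; first by nia.
have := path_sum_bounds p q n N i 1; rewrite addn1 !muln1.
by case/andP=> h1 h2; apply/andP; split; nia.
Qed.

Lemma path_word_shift p q n N : (0 < q)%N -> (0 < N <= n)%N ->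
  shift n (path_word p q n N) = path_word p q n N.
Proof.
move=> q0 /andP[N0 Nn]; have D0 : (0 < q * N)%N by rewrite muln_gt0 q0.
apply/funext => j; rewrite /shift /path_word /code -addnS !path_sum_shift //.
by rewrite !divnMDl // eqn_add2l.
Qed.

(** A shorter period would spread the period [q] of the flat stretch over the whole word and force
    1-ratio [p / q], but the ratio over [n] letters is strictly larger. *)
Lemma path_word_prim p q n N : (0 < q <= N)%N -> (p < q)%N ->
  (2 * (N + q) <= n)%N -> prim n (path_word p q n N).
Proof.
move=> /andP[q0 qN] pq nN; set x := path_word p q n N.
have D0 : (0 < q * N)%N by nia.
have e : shift n x = x by apply: path_word_shift; lia.
split=> // d /andP[d0 dn] ed.
(* With [d] also [n - d] is a period, so one at most half of [n] exists and fits inside the flat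
   stretch. *)
wlog d2 : d d0 dn ed / (2 * d <= n)%N.
  move=> H; case: (leqP (2 * d) n) => [|h]; first exact: H.
  apply: (H (n - d)%N); [lia | lia | | lia].
  by rewrite -{1}ed shiftD subnKC ?e // ltnW.
have xq i : (i + q < n - N)%N -> x (q + i)%N = x i.
  move=> hi; rewrite /x /path_word /code -addnS !path_sum_flat; try lia.
  have E k : (p * N * (q + k) = p * (q * N) + p * N * k)%N by rewrite mulnDr; nia.
  by rewrite !E !divnMDl // eqn_add2l.
have eq : shift q x = x.
  apply/funext => j; have modE i : x (j + i)%N = x (j %% d + i)%N.
    by have := congr1 (fun y => y i) (shift_modn j ed).
  rewrite /shift addnC modE addnC xq; last by have := ltn_pmod j d0; lia.
  by have := modE 0%N; rewrite !addn0.
have qNN : (0 < q <= N)%N by rewrite q0.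
(* The ones in [n * q] letters are counted twice, by the period [q] here and by the period [n]
   next. *)
have E1 : (cnt x (n * q) = n * p)%N.
  have := cnt_mul n 0 eq; rewrite cnt0 !addn0 => ->; congr (_ * _)%N.
  have := cnt_path_word n 0 q qNN pq.
  rewrite shift0 add0n !path_sum_flat ?muln0 ?div0n ?add0n; try lia.
  move=> ->; have -> : (p * N * q = p * (q * N))%N by lia.
  by rewrite mulnK.
have E2 : (cnt x (n * q) = q * (p * n %/ q).+1)%N.
  have := cnt_mul q 0 e; rewrite cnt0 !addn0 mulnC => ->; congr (_ * _)%N.
  have := cnt_path_word n 0 n qNN pq.
  rewrite shift0 add0n path_sum_period ?path_sum_flat ?muln0 ?div0n ?add0n; try lia.
  by move=> ->; rewrite mulnK.
by have := ltn_ceil (p * n) q0; rewrite [X in (_ < X)%N]mulnC -E2 E1 mulnC ltnn.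
Qed.

(** Slope at least [p / q] puts every point starting with 1 above [Tword]; the excess slope is so
    small that a point starting with 0 exceeds [Uword] by at most [(2 ^+ K)^-1]. *)
Lemma exists_avoiding (R : realType) p q (a b : R) :
  (0 < p < q)%N -> word_val R (Uword p q) < a -> b <= word_val R (Tword p q) ->
  exists n0, forall n, (n0 <= n)%N -> exists x, avoids a b n x.
Proof.
move=> /andP[p0 pq] Ua bT.
have [K hK] : exists K, (2 ^+ K)^-1 < a - word_val R (Uword p q).
  by apply: exp2V_small; rewrite subr_gt0.
have q0 : (0 < q)%N by lia.
(* Over at most [K.+1] steps the extra slope then adds at most [N], which is one unit of [p * k] in
   the scale [N]. *)
pose N := (K.+1 * q)%N; have qN : (0 < q <= N)%N by rewrite /N mulSn; lia.
exists (2 * (N + q))%N => n nN; exists (path_word p q n N).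
split; first exact: path_word_prim.
set x := path_word p q n N => j; have D0 : (0 < q * N)%N by rewrite muln_gt0; lia.
have segE k : cnt (shift j x) k.+1 = (x j + cnt (shift j.+1 x) k)%N.
  by rewrite cntSl shiftD addn1 /shift addn0.
set A := path_sum p q n N j.+1.
case: ifP => xj.
  apply: le_trans bT (val_le _ _) => -[|k]; first by rewrite cnt0.
  rewrite cnt_Tword // segE xj add1n ltnS -(leq_add2l (A %/ (q * N))).
  rewrite cnt_path_word //.
  have /andP[h _] := path_sum_bounds p q n N j.+1 k.
  apply: leq_trans (leq_div2r _ h); rewrite divnD //.
  rewrite -addnA leq_add2l; apply: leq_trans (leq_addr _ _).
  by rewrite mulnAC divnMr //; lia.
apply: le_trans (val_le_near (y := Uword p q) (n := K) _ _) _; last by lra.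
move=> [|[|k]] kK; [by rewrite cnt0 | by rewrite segE xj cnt0 |].
rewrite segE xj add0n cnt_Uword // -(leq_add2l (A %/ (q * N))).
rewrite cnt_path_word //.
have /andP[_ h] := path_sum_bounds p q n N j.+1 k.+1.
apply: leq_trans (leq_div2r _ h) _; rewrite -divnDMl //; apply: leq_div2r.
rewrite leq_add2l; have := ltn_ceil (p * k.+1) q0.
set f := (_ %/ q).+1 => hf.
(* [f * q] is an integer above [p * k.+1], so it leaves room for that one extra unit. *)
apply: leq_trans (_ : N * (p * k.+1).+1 <= _)%N; last first.
  by apply: leq_trans (_ : N * (f * q) <= _)%N; [rewrite leq_mul2l hf orbT | lia].
have : (q * k.+1 <= N)%N by rewrite /N mulnC leq_mul2r; lia.
by rewrite mulnS mulnDl; lia.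
Qed.

(** * Corners and their limits *)

Lemma near_box (R : realType) (u v a1 a2 b1 b2 : R) :
  a1 < u < a2 -> b1 < v < b2 ->
  \forall y \near (u, v), a1 < y.1 < a2 /\ b1 < y.2 < b2.
Proof.
move=> hu hv.
exists ([set x | a1 < x < a2], [set x | b1 < x < b2]) => [|y [] //]; split => /=.
  by apply: filterS (near_in_itvoo (_ : u \in `]a1, a2[));
    rewrite ?in_itv //= => x; rewrite in_itv.
by apply: filterS (near_in_itvoo (_ : v \in `]b1, b2[));
  rewrite ?in_itv //= => x; rewrite in_itv.
Qed.

Lemma nbhs_box (R : realType) (u v : R) (W : set (R * R)) : nbhs (u, v) W ->
  exists2 e, 0 < e & forall x y : R, `|u - x| < e -> `|v - y| < e -> W (x, y).
Proof.
move=> /nbhs_ballP[e /= e0 h]; exists e => // x y hx hy; apply: h.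
by split; rewrite /= -ball_normE.
Qed.

Lemma cnt_gt0 x k : (0 < cnt x k)%N -> exists j, x j.
Proof.
elim: k => [|k IH]; first by rewrite cnt0.
by rewrite cntS; case e : (x k); [exists k | rewrite addn0].
Qed.

Lemma Uword_bounds (R : realType) p q : (0 < p < q)%N ->
  1 / 4 < word_val R (Uword p q) < 1 / 2.
Proof.
move=> /andP[p0 pq]; rewrite /Uword; set w := shift 1 _.
have cw k : (0 < k)%N -> cnt w (k * q).-1 = (p * k)%N.
  move=> k0; apply: succn_inj; have := @cnt_Uword p q (k * q).-1 pq.
  rewrite 2!cnt_wcons add0n add1n => ->.
  rewrite prednK ?muln_gt0 ?k0 ?(leq_trans _ pq) // mulnA mulnK //.
  exact: leq_trans pq.
have [j wj] : exists j, w j by apply: (@cnt_gt0 _ (1 * q).-1); rewrite cw ?muln1.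
(* Two periods are taken because the first [q.-1] letters of [w] are all 1 when [p = q - 1]. *)
have [i wi] : exists i, ~~ w i.
  by apply: (@cnt_gt0 (flip w) (2 * q).-1); rewrite cnt_flip cw //; lia.
rewrite val_shift /= (_ : shift 1 _ = wcons true w) // val_shift /=.
rewrite (_ : shift 1 _ = w) //.
have := val_gt0 R wj; have := val_lt1 R wi; lra.
Qed.

Lemma Vword_bounds (R : realType) p q : (0 < p < q)%N ->
  1 / 2 < word_val R (Vword p q) < 3 / 4.
Proof.
move=> pq; have := @Uword_bounds R (q - p) q ltac:(lia).
by rewrite /Vword val_flip; lra.
Qed.

(** A ceiling is at most the floor plus 1, strictly less at integers, such as [p * k / q] at
    [k = q]. The gap gives the corner a neighbourhood on which [exists_avoiding] applies. *)
Lemma Vword_lt_Tword (R : realType) p q : (0 < p < q)%N ->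
  word_val R (Vword p q) < word_val R (Tword p q).
Proof.
move=> pq; have /andP[p0 pq'] := pq; apply: (@val_lt _ _ _ q.+1) => [[|[|k]]|].
- by rewrite !cnt0.
- by rewrite cnt_Tword // (leq_trans (cnt_le _ _)).
- rewrite cnt_Vword // cnt_Tword //.
  apply: leq_trans (leq_div2r q (_ : _ <= p * k.+1 + q)%N) _; first by lia.
  by rewrite divnDr // divnn (leq_trans _ pq') // addn1.
case: q pq pq' => // q pq pq'; rewrite cnt_Vword // cnt_Tword // mulnK //.
by rewrite divnMDl // divn_small //; lia.
Qed.

Lemma Sword_lt_Uword (R : realType) p q : (0 < p < q)%N ->
  word_val R (Sword p q) < word_val R (Uword p q).
Proof.
move=> pq; have := @Vword_lt_Tword R (q - p) q ltac:(lia).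
by rewrite /Sword /Vword !val_flip subKn; [lra | lia].
Qed.

Lemma D2_intro (R : realType) (a b : R) n0 : 1 / 4 < a < 1 / 2 ->
  1 / 2 < b < 3 / 4 -> (forall n, (n0 <= n)%N -> exists x, avoids a b n x) ->
  @D2 R (a, b).
Proof.
move=> ha hb h; split=> //=.
apply: (sub_finite_set _ (finite_II (maxn n0 3))) => n /= hn.
rewrite ltnNge; apply/negP; rewrite geq_max => /andP[/h ex n3].
have ab : a < 1 / 2 < b by lra.
by case/(bad_setP n3 ab): hn.
Qed.

Lemma notin_D2 (R : realType) p q (a b : R) : (0 < p < q)%N ->
  a < word_val R (Uword p q) -> word_val R (Vword p q) < b -> ~ @D2 R (a, b).
Proof.
move=> pq aU Vb [/= ha hb /finite_seqP[s hs]].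
(* This [n] exceeds every listed bad number and is 1 modulo [q]; an avoiding cycle would make [q]
   divide [p * n], hence [p], against [0 < p < q]. *)
pose M := (\max_(i <- s) i)%N; pose n := (q * (M + 3) + 1)%N.
have n3 : (3 <= n)%N by rewrite /n; nia.
have : bad_set a b n.
  apply/bad_setP => //; first by lra.
  case=> x /(avoids_ratio pq (ltnW n3)) /(_ aU Vb) e.
  have npq : ~~ (q %| p)%N by case/andP: pq => *; rewrite gtnNdvd.
  have : (q %| p * n)%N by rewrite e dvdn_mulr.
  rewrite /n mulnDr muln1 mulnCA dvdn_addr ?dvdn_mulr //.
  by rewrite (negbTE npq).
rewrite hs /= => ns; have : (n <= M)%N by exact: (@leq_bigmax_seq _ s xpredT id n).
by rewrite /n; nia.
Qed.

Lemma corner (R : realType) p q : (0 < p < q)%N ->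
  @is_corner R (word_val R (Uword p q), word_val R (Vword p q)).
Proof.
move=> pq; have hp : (0 < q - p < q)%N by lia.
have hU := Uword_bounds R pq; have hV := Vword_bounds R pq.
have SU := Sword_lt_Uword R pq; have VT := Vword_lt_Tword R pq.
have [/andP[U1 U2] /andP[V1 V2]] := (hU, hV).
have hU' : word_val R (Sword p q) < word_val R (Uword p q) < 1 / 2 by rewrite SU.
have hV' : 1 / 2 < word_val R (Vword p q) < word_val R (Tword p q) by rewrite VT V1.
apply: filterS2 (near_box hU hV) (near_box hU' hV') => -[a b] /=.
move=> [ha hb] [/andP[Sa _] /andP[_ bT]]; split; last first.
  by case=> aU Vb; exact: (notin_D2 pq).
case=> h.
  have [n0 hn] := exists_avoiding pq h (ltW bT).
  exact: D2_intro hn.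
(* The case of [b] below the corner is the first case after exchanging letters, which maps [(a, b)]
   to [(1 - b, 1 - a)] and [p] to [q - p]. *)
have h1 : word_val R (Uword (q - p) q) < 1 - b.
  by move: h; rewrite /Vword val_flip; lra.
have h2 : 1 - a <= word_val R (Tword (q - p) q).
  by move: Sa; rewrite /Sword val_flip; lra.
have [n0 hn] := exists_avoiding hp h1 h2.
apply: D2_intro ha hb (_ : forall n, (n0 <= n)%N -> _) => n /hn[x /avoids_flip].
by rewrite !subKr; exists (flip x).
Qed.

(** A small step to the right lands in [D2], a small step to the upper left lands outside it. *)
Lemma corner_frontier (R : realType) (z : R * R) :
  is_corner z -> frontier (@D2 R) z.
Proof.
case: z => u v hc; split.
  move=> W /(filterI hc)/nbhs_box[e e0 h]; exists (u + e / 2, v).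
  have [||[h1 _] h2] := h (u + e / 2) v; last first.
  - by split => //; apply: h1; left => /=; lra.
  - by rewrite subrr normr0.
  - by rewrite opprD addNKr normrN gtr0_norm; lra.
move=> /(filterI hc)/nbhs_box[e e0 h].
have [||[_ h1] h2] := h (u - e / 2) (v + e / 2); last first.
- by apply: h1 => //=; split; lra.
- by rewrite opprD addNKr normrN gtr0_norm; lra.
- by rewrite opprB addrC subrK gtr0_norm; lra.
Qed.

Lemma closed_frontier (T : topologicalType) (A : set T) : closed (frontier A).
Proof.
apply: closedI; first exact: closed_closure.
exact/open_closedC/open_interior.
Qed.

Lemma limit_corner_frontier (R : realType) (z : R * R) :
  limit_point (@is_corner R : set (R * R)) z -> frontier (@D2 R) z.
Proof.
move=> hz; apply: (@closed_frontier _ (@D2 R)) => W /hz[y [_ hy Wy]].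
by exists y; split => //; exact: corner_frontier.
Qed.

(** * Approximation by corners of nearby fractions *)

(** Lowering [p / q] by [1 / (q * N)] lowers [p * k / q] by less than [1 / q], so the result lies
    strictly between the integers [c] and [c.+1], the latter being the old ceiling. *)
Lemma ceil_approx p q N k : (0 < q)%N -> (0 < p)%N -> (0 < k < N)%N ->
  exists2 c, ((p * k + q.-1) %/ q = c.+1)%N &
    (c * (q * N) < (p * N - 1) * k < c.+1 * (q * N))%N.
Proof.
move=> q0 p0 /andP[k0 kN]; have := divn_bounds (p * k + q.-1) q0.
set c := (_ %/ q)%N => /andP[h1 h2].
have pk0 : (0 < p * k)%N by rewrite muln_gt0 p0.
have c0 : (0 < c)%N by case: c h2 {h1} => //; rewrite mul1n; lia.
exists c.-1; rewrite prednK //; move: c0 h1 h2; case: c => // c _ h1 h2 /=.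
have h3 : (c * q < p * k)%N by move: h1; rewrite mulSn; lia.
have h4 : (p * k <= c.+1 * q)%N by move: h2; rewrite !mulSn; lia.
have h5 : (c * q * N + N <= p * k * N)%N by rewrite -mulSnr leq_mul2r h3 orbT.
have h6 : (p * k * N <= c.+1 * q * N)%N by rewrite leq_mul2r h4 orbT.
have h7 : (0 < p * k * N)%N by rewrite muln_gt0 pk0; lia.
have -> : ((p * N - 1) * k = p * k * N - k)%N by rewrite mulnBl mul1n mulnAC.
by rewrite !mulnA; lia.
Qed.

Lemma approx_lt p q N : (0 < p < q)%N -> (1 < N)%N ->
  (0 < p * N - 1 < q * N)%N.
Proof.
move=> /andP[p0 pq] N1.
have : (p * N < q * N)%N by rewrite ltn_pmul2r //; lia.
by have : (1 * N <= p * N)%N; [rewrite leq_mul2r p0 orbT | lia].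
Qed.

Lemma cnt_Uword_approx p q N k : (0 < p < q)%N -> (1 < N)%N -> (k <= N)%N ->
  cnt (Uword (p * N - 1) (q * N)) k = cnt (Sword p q) k.
Proof.
move=> pq N1; have /andP[p0 pq'] := pq.
have /andP[_ pqN] := approx_lt pq N1.
case: k => [|[|k]] kN; first by rewrite !cnt0.
  by rewrite cnt_Sword // muln0 add0n divn_small ?cnt_wcons ?cnt0 //; lia.
rewrite cnt_Uword // cnt_Sword //.
have [||c -> h] := @ceil_approx p q N k.+1 _ p0; try lia.
by rewrite (@divn_unique _ _ c) //; lia.
Qed.

Lemma cnt_Vword_approx p q N k : (0 < p < q)%N -> (1 < N)%N -> (k <= N)%N ->
  cnt (Vword (p * N - 1) (q * N)) k = cnt (Vword p q) k.
Proof.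
move=> pq N1; have /andP[p0 pq'] := pq; have pqN := approx_lt pq N1.
case: k => [|[|k]] kN; first by rewrite !cnt0.
  by rewrite !cnt_flip !cnt_wcons !cnt0.
rewrite !cnt_Vword //.
have [||c -> h] := @ceil_approx p q N k.+1 _ p0; try lia.
by apply: divn_unique; rewrite !mulSn; move: h; rewrite mulSn; lia.
Qed.

(** Ensures that the approximating corners differ from their limit, as a limit point requires. *)
Lemma Uword_approx_lt (R : realType) p q N : (0 < p < q)%N -> (1 < N)%N ->
  word_val R (Uword (p * N - 1) (q * N)) < word_val R (Sword p q).
Proof.
move=> pq N1; have /andP[p0 pq'] := pq; have /andP[P0 pqN] := approx_lt pq N1.
have D0 : (0 < q * N)%N by lia.
have hN k : (0 < k)%N -> ((p * N - 1) * k < p * k * N)%N.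
  move=> k0; rewrite mulnBl mul1n mulnAC.
  by have : (0 < p * k * N)%N; [rewrite !muln_gt0 p0 k0 | ]; lia.
(* Two periods are needed: at [k = q * N] both counts equal [p * N]. *)
apply: (@val_lt _ _ _ (2 * (q * N)).+1) => [[|[|k]]|].
- by rewrite !cnt0.
- by rewrite cnt_wcons cnt0.
- rewrite cnt_Uword // cnt_Sword // ltn_divLR //.
  have /andP[_ h2] := divn_bounds (p * k.+1 + q.-1) (ltn_trans p0 pq').
  have h3 : (p * k.+1 <= (p * k.+1 + q.-1) %/ q * q)%N.
    by move: h2; rewrite mulSn; lia.
  by apply: leq_trans (hN k.+1 _) _ => //; rewrite mulnA leq_mul2r h3 orbT.
have [m hm] : exists m, (2 * (q * N) = m.+1)%N.
  by exists (2 * (q * N)).-1; rewrite prednK //; lia.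
rewrite hm cnt_Uword // cnt_Sword // -hm mulnA mulnK //.
have -> : (p * (2 * (q * N)) + q.-1 = (p * N * 2) * q + q.-1)%N by lia.
by rewrite divnMDl ?(ltn_trans p0) // divn_small; lia.
Qed.

Lemma limit_corner (R : realType) (u v : R) :
  (forall K, exists z : R * R, [/\ is_corner z, z != (u, v),
     `|z.1 - u| <= (2 ^+ K)^-1 & `|z.2 - v| <= (2 ^+ K)^-1]) ->
  limit_point (@is_corner R : set (R * R)) (u, v).
Proof.
move=> h W /nbhs_box[e e0 hW]; have [K hK] := exp2V_small e0.
have [[x y] /= [hc hz h1 h2]] := h K; exists (x, y); split=> //.
by apply: hW; rewrite distrC; [apply: le_lt_trans h1 _ | apply: le_lt_trans h2 _].
Qed.

Lemma limit_left (R : realType) p q : (0 < p < q)%N ->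
  limit_point (@is_corner R : set (R * R))
    (word_val R (Sword p q), word_val R (Vword p q)).
Proof.
move=> pq; apply: limit_corner => K; have N1 : (1 < K.+2)%N by [].
exists (word_val R (Uword (p * K.+2 - 1) (q * K.+2)),
        word_val R (Vword (p * K.+2 - 1) (q * K.+2))); split=> /=.
- exact/corner/approx_lt.
- apply/eqP => -[h _]; have := Uword_approx_lt R pq N1.
  by rewrite h ltxx.
- by apply: val_near => k kK; apply: cnt_Uword_approx => //; lia.
- by apply: val_near => k kK; apply: cnt_Vword_approx => //; lia.
Qed.

(** Mirror image of [limit_left]: the approximations of [(q - p) / q] from below become, after
    exchanging letters, the corners of [(p * N + 1) / (q * N)]. *)
Lemma limit_right (R : realType) p q : (0 < p < q)%N ->
  limit_point (@is_corner R : set (R * R))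
    (word_val R (Uword p q), word_val R (Tword p q)).
Proof.
move=> pq; have hp : (0 < q - p < q)%N by lia.
have norm1B (a b : R) : `|1 - a - (1 - b)| = `|a - b|.
  by rewrite -[RHS]normrN; congr `|_|; ring.
apply: limit_corner => K; have N1 : (1 < K.+2)%N by [].
pose P := ((q - p) * K.+2 - 1)%N; pose Q := (q * K.+2)%N.
have hP : (0 < P < Q)%N by exact: approx_lt.
have EU : Uword p q = flip (Vword (q - p) q) by rewrite /Vword flipK subKn //; lia.
have ET : Tword p q = flip (Sword (q - p) q) by rewrite /Sword flipK subKn //; lia.
have e1 : `|word_val R (Uword P Q) - word_val R (Sword (q - p) q)| <= (2 ^+ K)^-1.
  by apply: val_near => k kK; apply: cnt_Uword_approx => //; lia.
have e2 : `|word_val R (Vword P Q) - word_val R (Vword (q - p) q)| <= (2 ^+ K)^-1.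
  by apply: val_near => k kK; apply: cnt_Vword_approx => //; lia.
have EU' : Uword (Q - P) Q = flip (Vword P Q) by rewrite /Vword flipK.
have EV' : Vword (Q - P) Q = flip (Uword P Q) by rewrite /Vword subKn //; lia.
exists (word_val R (flip (Vword P Q)), word_val R (flip (Uword P Q))).
split=> /=.
- by rewrite -EU' -EV'; apply: corner; lia.
- apply/eqP => -[_]; rewrite ET [LHS]val_flip [RHS]val_flip => h.
  have := Uword_approx_lt R hp N1.
  by rewrite -/P -/Q; lra.
- by rewrite EU !(val_flip R (Vword _ _)) norm1B.
- by rewrite ET (val_flip R (Uword _ _)) (val_flip R (Sword _ _)) norm1B.
Qed.

(** * The words s(r) and t(r) *)

Lemma mkseqD z a b : mkseq z (a + b) = mkseq z a ++ mkseq (shift a z) b.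
Proof.
rewrite /mkseq iotaD map_cat add0n; congr (_ ++ _).
by rewrite -{1}[a]addn0 iotaDl -map_comp.
Qed.

Lemma ones_mkseq z k : ones (mkseq z k) = cnt z k.
Proof.
elim: k => [|k IH]; first by rewrite cnt0.
rewrite -addn1 mkseqD /ones count_cat -/(ones _) IH addn1 cntS /= addn0.
by rewrite /shift addn0; case: (z k).
Qed.

Lemma word_pow_inf_mkseq x q : (0 < q)%N -> shift q x = x ->
  word_pow_inf (mkseq x q) = x.
Proof.
move=> q0 e; apply/funext => j.
rewrite /word_pow_inf size_mkseq nth_mkseq ?ltn_mod //.
by have := congr1 (fun y => y 0%N) (shift_modn j e); rewrite /shift !addn0.
Qed.

Lemma mkseq_word_pow_inf w : mkseq (word_pow_inf w) (size w) = w.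
Proof.
apply: (@eq_from_nth _ false); rewrite ?size_mkseq // => i hi.
by rewrite nth_mkseq // /word_pow_inf modn_small.
Qed.

Lemma shift_word_pow_inf w : shift (size w) (word_pow_inf w) = word_pow_inf w.
Proof. by apply/funext => j; rewrite /shift /word_pow_inf modnDl. Qed.

Lemma rot_mkseq x q k : shift q x = x -> (k <= q)%N ->
  rot k (mkseq x q) = mkseq (shift k x) q.
Proof.
move=> e kq; have := rot_size_cat (mkseq x k) (mkseq (shift k x) (q - k)).
rewrite size_mkseq -mkseqD subnKC // => ->.
have -> : mkseq x k = mkseq (shift (q - k) (shift k x)) k.
  by rewrite shiftD subnKC ?e.
by rewrite -mkseqD subnK.
Qed.

Lemma balanced_mkseqP z q : balanced (mkseq z q) <->
  forall a b k, (a + k <= q)%N -> (b + k <= q)%N ->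
    (cnt (shift a z) k <= (cnt (shift b z) k).+1)%N.
Proof.
split=> [h a b k ak bk | h k u v k0].
  have inf c : (c + k <= q)%N -> infix (mkseq (shift c z) k) (mkseq z q).
    move=> ck; rewrite -(subnKC ck) !mkseqD; apply/infixP.
    by eexists; eexists; rewrite -catA.
  case: (posnP k) => [-> | k0]; first by rewrite !cnt0.
  have := h k _ _ k0 (inf a ak) (inf b bk); rewrite !size_mkseq !ones_mkseq.
  by move=> /(_ erefl erefl); lia.
have seg w : infix w (mkseq z q) -> size w = k ->
    exists2 a, (a + k <= q)%N & ones w = cnt (shift a z) k.
  move=> /infixP[s1 [s2 e]] wk; have := congr1 size e.
  rewrite size_mkseq !size_cat wk => eq; exists (size s1); first by lia.
  move: e; rewrite eq mkseqD mkseqD => /eqP; rewrite eqseq_cat ?size_mkseq //.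
  case/andP=> _; rewrite eqseq_cat ?size_mkseq // => /andP[/eqP <- _].
  by rewrite ones_mkseq.
move=> /seg hu /seg hv /hu[a ak ->] /hv[b bk ->].
by have := h a b k ak bk; have := h b a k bk ak; lia.
Qed.

Lemma cyclically_balanced_mkseq x q : shift q x = x ->
  (forall i j k, cnt (shift i x) k <= (cnt (shift j x) k).+1)%N ->
  cyclically_balanced (mkseq x q).
Proof.
move=> e h k; wlog kq : k / (k <= q)%N.
  case: (leqP k q) => [|qk]; first by move=> kq; apply.
  by move=> /(_ 0%N); rewrite rot0 rot_oversize ?size_mkseq ?(ltnW qk) //; apply.
rewrite rot_mkseq //; apply/balanced_mkseqP => a b j _ _.
by rewrite !shiftD; exact: h.
Qed.

(* Two arcs of length [k] on a cycle of length [q] lie in a common window of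
   length [q], unless they cover the cycle; then their complements do. *)
Lemma cyclically_balanced_cnt x q i j k : (0 < q)%N -> shift q x = x ->
  cyclically_balanced (mkseq x q) -> (k <= q)%N ->
  (cnt (shift i x) k <= (cnt (shift j x) k).+1)%N.
Proof.
move=> q0 e h.
have win i' a b k' : (a + k' <= q)%N -> (b + k' <= q)%N ->
    (cnt (shift (i' + a) x) k' <= (cnt (shift (i' + b) x) k').+1)%N.
  have := h (i' %% q)%N; rewrite rot_mkseq // ?(ltnW (ltn_pmod _ q0)) //.
  by rewrite shift_modn // -!shiftD => /balanced_mkseqP; apply.
have near i' d k' : (d + k' <= q)%N ->
    (cnt (shift i' x) k' <= (cnt (shift (i' + d) x) k').+1)%N /\
    (cnt (shift (i' + d) x) k' <= (cnt (shift i' x) k').+1)%N.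
  move=> dk; have kq : (0 + k' <= q)%N by lia.
  have := win i' 0%N d k' kq dk; have := win i' d 0%N k' dk kq.
  by rewrite addn0; split.
have diff d k' i' : (d < q)%N -> (k' <= q)%N ->
    (cnt (shift i' x) k' <= (cnt (shift (i' + d) x) k').+1)%N /\
    (cnt (shift (i' + d) x) k' <= (cnt (shift i' x) k').+1)%N.
  move=> dq kq; have [|dk] := leqP (d + k') q; first exact: near.
  have [kd|kd] := leqP k' d.
    (* Read from [i' + d], the other arc starts [q - d] letters later, within one window. *)
    have := near (i' + d)%N (q - d)%N k'; rewrite -addnA subnKC ?(ltnW dq) //.
    by rewrite [(i' + q)%N]addnC -(shiftD i') e => -[|? ?] //; lia.
  have := near (i' + k')%N d (q - k')%N; case; first by lia.
  have E a : (cnt (shift a x) k' + cnt (shift (a + k') x) (q - k') = cnt x q)%N.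
    by rewrite -shiftD -cntD subnKC // cnt_shift_period.
  by have := E i'; have := E (i' + d)%N; rewrite addnAC; lia.
move=> kq; rewrite -(shift_modn i e) -(shift_modn j e).
have := ltn_pmod i q0; have := ltn_pmod j q0.
move: (i %% q)%N (j %% q)%N => a b bq aq.
case: (leqP a b) => ab.
  by have [] := diff (b - a)%N k a _ kq; [lia | rewrite subnKC].
by have [] := diff (a - b)%N k b _ kq; [lia | rewrite subnKC // ltnW].
Qed.

(** The cycle lemma, for [x] and for [flip x], gives arcs of length [k] with at least and at most
    [p * k / q] ones; this is no integer, and balance moves the count by at most 1. *)
Lemma cnt_balanced_bounds p q x j k : (0 < q)%N -> coprime p q ->
  shift q x = x -> cnt x q = p -> cyclically_balanced (mkseq x q) ->
  (0 < k < q)%N ->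
  (p * k %/ q <= cnt (shift j x) k <= (p * k %/ q).+1)%N.
Proof.
move=> q0 cpq e xp cb /andP[k0 kq].
have bal a b := cyclically_balanced_cnt a b q0 e cb (ltnW kq).
have npk : ~~ (q %| p * k)%N by rewrite Gauss_dvdr ?gtnNdvd // coprime_sym.
have [m hm] := cycle_lemma q0 e.
have [m' hm'] : exists m, (q * cnt (shift m x) k <= p * k)%N.
  have [m' /(_ k)] := @cycle_lemma (flip x) q q0 ltac:(by rewrite shift_flip e).
  rewrite shift_flip !cnt_flip xp mulnBl mulnBr => h; exists m'.
  have := cnt_le (shift m' x) k; have := cnt_le x q; rewrite xp => h1 h2.
  have h3 : (p * k <= q * k)%N by rewrite leq_mul2r h1 orbT.
  have h4 : (q * cnt (shift m' x) k <= q * k)%N by rewrite leq_mul2l h2 orbT.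
  lia.
apply/andP; split.
  apply: leq_trans (_ : (cnt (shift m x) k).-1 <= _)%N; last first.
    by have := bal m j; lia.
  have : (p * k < q * cnt (shift m x) k)%N.
    rewrite ltn_neqAle -{2}xp hm andbT; apply: contra npk => /eqP ->.
    exact: dvdn_mulr.
  by rewrite [X in (_ < X)%N]mulnC -ltn_divLR //; lia.
apply: leq_trans (bal j m') _; by rewrite ltnS leq_divRL // mulnC.
Qed.

(** At the first letter where the words differ, the count comparison forces 0 in [x] and 1 in
    [y]. *)
Lemma lex_le_mkseq x y n :
  (forall k, (k <= n)%N -> (cnt x k <= cnt y k)%N) ->
  lex_le (mkseq x n) (mkseq y n).
Proof.
elim: n x y => [|n IH] x y h; first by rewrite /lex_le.
rewrite -add1n !mkseqD /lex_le /= Order.SeqLexiOrder.Exports.lexi_cons.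
have := h 1%N isT; rewrite !cntS !cnt0 !add0n => h1.
apply/andP; split; first by move: h1; case: (x 0%N); case: (y 0%N).
apply/implyP => h2; apply: IH => k kn; have := h k.+1 kn; rewrite !cntSl.
by move: h1 h2; case: (x 0%N); case: (y 0%N); rewrite ?ltnS.
Qed.

(** Absorbing the leading 1 into the offset [q - p] makes the period [q] and the balance of this
    word visible. *)
Lemma TwordE p q : (0 < p < q)%N ->
  Tword p q = code (fun j => p * j + (q - p))%N q.
Proof.
move=> /andP[p0 pq]; apply: eq_cnt => -[|k]; first by rewrite !cnt0.
have := @cnt_code (fun j => p * j + (q - p))%N q 0 k.+1.
rewrite shift0 muln0 add0n divn_small ?add0n; last by lia.
move=> ->; [|lia|by move=> i; rewrite mulnS; lia].
rewrite cnt_Tword // mulnS (_ : (_ + _ = p * k + 1 * q)%N); last by lia.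
by rewrite divnDMl ?addn1 //; lia.
Qed.

Lemma shift_Tword p q : (0 < p < q)%N -> shift q (Tword p q) = Tword p q.
Proof.
move=> pq; rewrite TwordE //; apply/funext => j; rewrite /shift /code.
have E i : (p * (q + i) + (q - p) = p * q + (p * i + (q - p)))%N by lia.
by rewrite -addnS !E !divnMDl ?eqn_add2l //; lia.
Qed.

Lemma cnt_shift_Tword p q j k : (0 < p < q)%N ->
  (p * k %/ q <= cnt (shift j (Tword p q)) k <= (p * k %/ q).+1)%N.
Proof.
move=> pq; have q0 : (0 < q)%N by lia.
have := @cnt_code (fun j => p * j + (q - p))%N q j k q0.
rewrite -TwordE // => h; have {}h := h ltac:(by move=> i; rewrite mulnS; lia).
move: h; rewrite mulnDr addnAC; set A := (_ + (q - p))%N.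
by rewrite divnD //; case: leqP => _; lia.
Qed.

Lemma cnt_Tword_balanced p q i j k : (0 < p < q)%N ->
  (cnt (shift i (Tword p q)) k <= (cnt (shift j (Tword p q)) k).+1)%N.
Proof.
by move=> pq; have := cnt_shift_Tword i k pq; have := cnt_shift_Tword j k pq; lia.
Qed.

Lemma cnt_Sword_balanced p q i j k : (0 < p < q)%N ->
  (cnt (shift i (Sword p q)) k <= (cnt (shift j (Sword p q)) k).+1)%N.
Proof.
move=> pq; rewrite !shift_flip !cnt_flip.
have hp : (0 < q - p < q)%N by lia.
by have := cnt_Tword_balanced j i k hp; lia.
Qed.

Lemma shift_Sword p q : (0 < p < q)%N -> shift q (Sword p q) = Sword p q.
Proof. by move=> pq; rewrite shift_flip shift_Tword //; lia. Qed.

Lemma cnt_Tword_size p q : (0 < p < q)%N -> cnt (Tword p q) q = p.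
Proof.
case: q => [|q]; first by lia.
move=> /andP[p0 pq]; rewrite cnt_Tword //.
by rewrite (@divn_unique _ _ p.-1) ?prednK //; nia.
Qed.

Lemma cnt_Sword_size p q : (0 < p < q)%N -> cnt (Sword p q) q = p.
Proof. by move=> pq; rewrite cnt_flip cnt_Tword_size; lia. Qed.

Lemma floor_ceil p q k : coprime p q -> (0 < k < q)%N ->
  ((p * k + q.-1) %/ q = (p * k %/ q).+1)%N.
Proof.
move=> cpq /andP[k0 kq]; have q0 : (0 < q)%N by lia.
have : ~~ (q %| p * k)%N by rewrite Gauss_dvdr ?gtnNdvd // coprime_sym.
rewrite /dvdn -lt0n => h; have := divn_eq (p * k) q; have := ltn_pmod (p * k) q0.
move: (_ %/ q)%N (_ %% q)%N h => f m h mq ->.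
by apply: divn_unique; rewrite !mulSn; lia.
Qed.

(** * The concatenations of s and t *)

Lemma word_cat_infE x y q :
  word_cat_inf (mkseq x q) y = fun j => if (j < q)%N then x j else y (j - q)%N.
Proof.
apply/funext => j; rewrite /word_cat_inf size_mkseq.
by case: ltnP => // h; rewrite nth_mkseq.
Qed.

Lemma shift_word_cat_inf x y q : shift q (word_cat_inf (mkseq x q) y) = y.
Proof.
apply/funext => j; rewrite word_cat_infE /shift ifF ?addKn //.
by apply/negbTE; rewrite -leqNgt leq_addr.
Qed.

Lemma cnt_word_cat_inf x y q k : (k <= q)%N ->
  cnt (word_cat_inf (mkseq x q) y) k = cnt x k.
Proof.
elim: k => [|k IH] kq; first by rewrite !cnt0.
by rewrite !cntS IH ?(ltnW kq) // word_cat_infE kq.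
Qed.

(** By coprimality the ceiling is the floor plus 1 strictly inside the first period, so [Sword] and
    [Uword] agree there; after [q] letters both sides have gained [p] ones. *)
Lemma UwordE p q : (0 < p < q)%N -> coprime p q ->
  word_cat_inf (mkseq (Sword p q) q) (Tword p q) = Uword p q.
Proof.
move=> pq cpq; have /andP[p0 pq'] := pq; apply: eq_cnt => k.
have [kq|qk] := leqP k q.
  rewrite cnt_word_cat_inf //; case: k kq => [|[|k]] kq; first by rewrite !cnt0.
    by rewrite cnt_Sword // muln0 add0n divn_small ?cnt_wcons ?cnt0 //; lia.
  by rewrite cnt_Sword // cnt_Uword // floor_ceil.
have [m ->] : exists m, k = (q + m.+1)%N by exists (k - q).-1; lia.
rewrite cntD shift_word_cat_inf cnt_word_cat_inf // cnt_Sword_size // cnt_Tword //.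
have -> : (q + m.+1 = (q.-1 + m).+2)%N by lia.
rewrite cnt_Uword // -addSn prednK; last by lia.
by rewrite mulnDr divnMDl ?addnS //; lia.
Qed.

Lemma flip_word_cat_inf x y q :
  flip (word_cat_inf (mkseq x q) y) = word_cat_inf (mkseq (flip x) q) (flip y).
Proof.
by rewrite !word_cat_infE; apply/funext => j; rewrite /flip; case: ifP.
Qed.

Lemma coprime_subn p q : (p <= q)%N -> coprime (q - p) q = coprime p q.
Proof.
move=> pq; rewrite /coprime -{2 3}(subnK pq) gcdnDl gcdnDr.
by rewrite gcdnC.
Qed.

Lemma VwordE p q : (0 < p < q)%N -> coprime p q ->
  word_cat_inf (mkseq (Tword p q) q) (Sword p q) = Vword p q.
Proof.
move=> pq cpq; have /andP[_ /ltnW pq'] := pq.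
rewrite /Vword -UwordE ?coprime_subn //; last by lia.
by rewrite flip_word_cat_inf /Sword flipK subKn.
Qed.

(** * Identification of s(r) and t(r) *)

Lemma rat_parts (r : rat) : 0 < r < 1 -> exists p q : nat,
  [/\ (0 < p < q)%N, coprime p q, denq r = q%:Z & r = p%:R / q%:R].
Proof.
move=> /andP[r0 r1]; exists `|numq r|%N, `|denq r|%N.
have n0 : 0 < numq r by rewrite numq_gt0.
have nE : numq r = `|numq r|%N by rewrite gez0_abs // ltW.
have dE : denq r = `|denq r|%N by rewrite absz_denq.
have rE : r = `|numq r|%N%:R / `|denq r|%N%:R.
  by rewrite -{1}(divq_num_den r) {1}nE {1}dE.
split=> //; last exact: coprime_num_den.
rewrite absz_gt0 gt_eqF //=; move: r1; rewrite {1}rE ltr_pdivrMr ?mul1r ?ltr_nat //.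
by rewrite ltr0n absz_gt0 denq_neq0.
Qed.

Lemma cb_wordsP (r : rat) p q c w : (0 < q)%N -> denq r = q%:Z ->
  r = p%:R / q%:R -> cb_words r c w <->
  [/\ size w = q, ones w = p, cyclically_balanced w & ohead w = Some c].
Proof.
move=> q0 dr rE; have q_neq0 : q%:R != 0 :> rat by rewrite pnatr_eq0; lia.
split=> -[hs ho hb hc]; split=> //.
- by move: hs; rewrite dr => -[].
- move: ho hs; rewrite /one_ratio dr rE => /[swap] -[->] /(divIf q_neq0) /eqP.
  by rewrite eqr_nat => /eqP.
- by rewrite hs dr.
- by rewrite /one_ratio hs ho.
Qed.

Lemma lex_le_anti u v : lex_le u v -> lex_le v u -> u = v.
Proof.
move=> h1 h2; apply: (@Order.POrderTheory.le_anti _ (seqlexi bool)).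
by rewrite -/(lex_le u v) -/(lex_le v u) h1.
Qed.

Lemma cb_words_mkseq (r : rat) p q x : (0 < q)%N -> denq r = q%:Z ->
  r = p%:R / q%:R -> shift q x = x -> cnt x q = p ->
  (forall i j k, cnt (shift i x) k <= (cnt (shift j x) k).+1)%N ->
  cb_words r (x 0%N) (mkseq x q).
Proof.
move=> q0 dr rE e xp bal; apply/(cb_wordsP _ _ q0 dr rE); split.
- by rewrite size_mkseq.
- by rewrite ones_mkseq.
- exact: cyclically_balanced_mkseq.
- by case: q q0 {dr rE e xp}.
Qed.

Lemma cb_words_cnt (r : rat) p q c w k : (0 < q)%N -> denq r = q%:Z ->
  r = p%:R / q%:R -> coprime p q -> cb_words r c w -> (0 < k < q)%N ->
  (c + p * k %/ q <= cnt (word_pow_inf w) k.+1 <= c + (p * k %/ q).+1)%N.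
Proof.
move=> q0 dr rE cpq /(cb_wordsP _ _ q0 dr rE)[ws wp cb wc] kq.
have e : shift q (word_pow_inf w) = word_pow_inf w.
  by rewrite -ws shift_word_pow_inf.
have wE : mkseq (word_pow_inf w) q = w by rewrite -ws mkseq_word_pow_inf.
have := @cnt_balanced_bounds p q (word_pow_inf w) 1 k q0 cpq e.
rewrite wE -ones_mkseq wE => /(_ wp cb kq); rewrite cntSl.
have -> : word_pow_inf w 0%N = c.
  by case: w wc {ws wp cb e wE} => //= b w [<-].
by rewrite !leq_add2l.
Qed.

(** The prefix counts of [Sword] attain the upper bound of [cb_words_cnt] for words starting with 0,
    so it dominates every candidate lexicographically. *)
Lemma s_wordE (r : rat) p q : (0 < p < q)%N -> coprime p q ->
  denq r = q%:Z -> r = p%:R / q%:R -> s_word r = mkseq (Sword p q) q.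
Proof.
move=> pq cpq dr rE; have q0 : (0 < q)%N by lia.
have hS : cb_words r false (mkseq (Sword p q) q).
  apply: (cb_words_mkseq (x := Sword p q) q0 dr rE).
  - exact: shift_Sword.
  - exact: cnt_Sword_size.
  - by move=> *; apply: cnt_Sword_balanced.
have maxS v : cb_words r false v -> lex_le v (mkseq (Sword p q) q).
  move=> hv; have [vs _ _ vc] := (cb_wordsP _ _ q0 dr rE).1 hv.
  rewrite -[v]mkseq_word_pow_inf vs; apply: lex_le_mkseq => -[|k] kq.
    by rewrite !cnt0.
  rewrite cnt_Sword //; case: k kq => [|k] kq.
    rewrite cntS cnt0 /word_pow_inf.
    by case: v vc {hv vs} => //= b v [->].
  have := cb_words_cnt q0 dr rE cpq hv (_ : 0 < k.+1 < q)%N.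
  by rewrite floor_ceil // add0n => /(_ kq) /andP[].
apply: xget_unique => [|w [hw maxw]]; first by split.
by apply: lex_le_anti; [exact: maxS | exact: maxw].
Qed.

(** Here the prefix counts attain the lower bound of [cb_words_cnt] for words starting with 1. *)
Lemma t_wordE (r : rat) p q : (0 < p < q)%N -> coprime p q ->
  denq r = q%:Z -> r = p%:R / q%:R -> t_word r = mkseq (Tword p q) q.
Proof.
move=> pq cpq dr rE; have q0 : (0 < q)%N by lia.
have pq' : (p < q)%N by lia.
have hT : cb_words r true (mkseq (Tword p q) q).
  apply: (cb_words_mkseq (x := Tword p q) q0 dr rE).
  - exact: shift_Tword.
  - exact: cnt_Tword_size.
  - by move=> *; apply: cnt_Tword_balanced.
have minT v : cb_words r true v -> lex_le (mkseq (Tword p q) q) v.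
  move=> hv; have [vs _ _ vc] := (cb_wordsP _ _ q0 dr rE).1 hv.
  rewrite -[v]mkseq_word_pow_inf vs; apply: lex_le_mkseq => -[|k] kq.
    by rewrite !cnt0.
  rewrite cnt_Tword //; case: k kq => [|k] kq.
    rewrite cntS cnt0 /word_pow_inf muln0 div0n.
    by case: v vc {hv vs} => //= b v [->].
  by have := cb_words_cnt q0 dr rE cpq hv (_ : 0 < k.+1 < q)%N => /(_ kq) /andP[].
apply: xget_unique => [|w [hw minw]]; first by split.
by apply: lex_le_anti; [exact: minw | exact: minT].
Qed.

Theorem theorem3p8 (R : realType) (r : rat) (hr : 0 < r < 1) :
  let s := s_word r in
  let t := t_word r in
  let s_inf : R := word_val R (word_pow_inf s) in
  let t_inf : R := word_val R (word_pow_inf t) in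
  let st_inf : R := word_val R (word_cat_inf s (word_pow_inf t)) in
  let ts_inf : R := word_val R (word_cat_inf t (word_pow_inf s)) in
  [/\ frontier (@D2 R) (s_inf, ts_inf),
      frontier (@D2 R) (st_inf, ts_inf) &
      frontier (@D2 R) (st_inf, t_inf)] /\
  is_corner (st_inf, ts_inf) /\
  limit_point (@is_corner R : set (R * R)) (s_inf, ts_inf) /\
  limit_point (@is_corner R : set (R * R)) (st_inf, t_inf).
Proof.
have [p [q [pq cpq dr rE]]] := rat_parts hr; have q0 : (0 < q)%N by lia.
rewrite (s_wordE pq cpq dr rE) (t_wordE pq cpq dr rE) /=.
rewrite (word_pow_inf_mkseq q0 (shift_Sword pq)).
rewrite (word_pow_inf_mkseq q0 (shift_Tword pq)) UwordE // VwordE //.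
have c := corner R pq; have l1 := @limit_left R p q pq.
have l2 := @limit_right R p q pq.
split; last by [].
by split; [exact: limit_corner_frontier | exact: corner_frontier
          | exact: limit_corner_frontier].
Qed.
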